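(* Let $\Gamma$ be a finitely presented residually finite group. Then for every finite generating set $X$ of $\Gamma$, the residual finiteness growth function $\mathrm{F}_{\Gamma,X} : \mathbb{N} \to \mathbb{N}$ is computable.
   Context: Here $\mathbb{N} = \{1,2,3,\ldots\}$. Let $\Gamma$ be a residually finite group generated by a finite set $X$. An element $\gamma \in \Gamma$ is detected by a finite quotient $Q$ of $\Gamma$ if there is a surjective homomorphism $\phi : \Gamma \to Q$ with $\gamma \notin \ker \phi$. The residual finiteness growth function $\mathrm{F}_{\Gamma, X} : \mathbb{N} \to \mathbb{N}$ is defined by letting $\mathrm{F}_{\Gamma,X}(n)$ be the minimal natural number $N$ such that every nontrivial element of $\Gamma$ of word length $\leq n$ with respect to $X$ (that is, expressible as a product of at most $n$ elements of $X \cup X^{-1}$) is detected by some finite quotient $Q$ of $\Gamma$ (which may depend on the element) of cardinality $\leq N$. A function $\mathbb{N} \to \mathbb{N}$ is computable if it is computed by an algorithm (Turing machine), i.e. is a total recursive function. *)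

(* Defs.v *)
From HB Require Import structures.
From mathcomp Require Import all_boot all_fingroup.
From mathcomp Require Import finmap.
From mathcomp Require Import boolp classical_sets.

Set Implicit Arguments.
Unset Strict Implicit.
Unset Printing Implicit Defensive.

Local Open Scope group_scope.

(* In MathComp a [groupType] carries decidable equality and a choice operator;
   classically every group does, so this is no restriction. *)
Definition word_length_le (G : groupType) (X : {fset G}) (n : nat) (g : G) :
    Prop :=
  exists s : seq G,
    [/\ (size s <= n)%N,
        all (fun x => (x \in X) || (x^-1 \in X)) s
      & g = \prod_(x <- s) x].

Definition generates (G : groupType) (X : {fset G}) : Prop :=
  forall g : G, exists n : nat, word_length_le X n g.

(* Words in k letters and their formal inverses: [(i, false)] stands for the
   i-th letter and [(i, true)] for its inverse. *)
Definition word (k : nat) := seq ('I_k * bool).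

Definition word_eval (G : groupType) (k : nat) (s : 'I_k -> G) (w : word k) : G :=
  \prod_(a <- w) (if a.2 then (s a.1)^-1 else s a.1).

(* The group with k generators and relators R is the monoid of words modulo
   the following congruence. *)
Inductive word_equiv (k : nat) (R : seq (word k)) : word k -> word k -> Prop :=
| WE_refl w : word_equiv R w w
| WE_sym w w' : word_equiv R w w' -> word_equiv R w' w
| WE_trans w w' w'' :
    word_equiv R w w' -> word_equiv R w' w'' -> word_equiv R w w''
| WE_cat u u' v v' :
    word_equiv R u u' -> word_equiv R v v' -> word_equiv R (u ++ v) (u' ++ v')
| WE_cancel i b : word_equiv R [:: (i, b); (i, ~~ b)] [::]
| WE_relator r : r \in R -> word_equiv R r [::].

(* Sending the i-th letter to [s i] induces an isomorphism from the group
   with k generators and relators R onto G. *)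
Definition presented_by (G : groupType) (k : nat) (R : seq (word k))
    (s : 'I_k -> G) : Prop :=
  (forall g : G, exists w : word k, word_eval s w = g) /\
  (forall w w' : word k, word_eval s w = word_eval s w' <-> word_equiv R w w').

Definition finitely_presented (G : groupType) : Prop :=
  exists (k : nat) (R : seq (word k)) (s : 'I_k -> G), presented_by R s.

Definition detected_by (G : groupType) (Q : finGroupType) (g : G) : Prop :=
  exists phi : {multiplicative G -> Q},
    (forall q : Q, exists h : G, phi h = q) /\ phi g <> 1.

Definition residually_finite (G : groupType) : Prop :=
  forall g : G, g <> 1 -> exists Q : finGroupType, detected_by Q g.

Definition detection_bound (G : groupType) (X : {fset G}) (n N : nat) : Prop :=
  forall g : G, g <> 1 -> word_length_le X n g ->
    exists Q : finGroupType, detected_by Q g /\ (#|Q| <= N)%N.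

(* The natural numbers start at 1, whence [0 < N]: if no nontrivial element has
   length at most n then the minimum is 1. *)
Definition is_rf_growth (G : groupType) (X : {fset G}) (n N : nat) : Prop :=
  [/\ (0 < N)%N, detection_bound X n N
    & forall M : nat, (0 < M)%N -> detection_bound X n M -> (N <= M)%N].

(* The default value 0 is never taken when G is residually finite: see
   [rf_growthP]. *)
Definition rf_growth (G : groupType) (X : {fset G}) (n : nat) : nat :=
  xget 0%N [set N : nat | is_rf_growth X n N]%classic.

Lemma ball_finite (G : groupType) (X : {fset G}) (n : nat) :
  exists L : seq G, forall g : G, word_length_le X n g -> g \in L.
Proof.
elim: n => [|n [L HL]].
  by exists [:: 1] => g [s [+ _ ->]]; rewrite leqn0 => /nilP->; rewrite big_nil mem_seq1.
pose A : seq G := enum_fset X ++ [seq x^-1 | x <- enum_fset X].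
exists (1 :: [seq x * h | x <- A, h <- L]) => g [[|x s] [Hs Hall ->]].
  by rewrite big_nil mem_head.
move: Hall => /= /andP[Hx Hall].
rewrite big_cons inE; apply/orP; right.
apply: allpairs_f; last by apply: HL; exists s; split.
rewrite mem_cat; case/orP: Hx => Hx; first by rewrite Hx.
by apply/orP; right; apply/mapP; exists x^-1; rewrite ?invgK.
Qed.

Lemma rf_growthP (G : groupType) (X : {fset G}) (n : nat) :
  residually_finite G -> is_rf_growth X n (rf_growth X n).
Proof.
move=> rfG.
suff [N HN] : exists N, is_rf_growth X n N by apply: (xgetI 0%N HN).
have [L HL] := ball_finite X n.
pose P N := `[< (0 < N)%N /\ detection_bound X n N >].
have exP : exists N, P N.
  suff [N HN] : exists N, forall g, g \in L -> g <> 1 ->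
      exists Q : finGroupType, detected_by Q g /\ (#|Q| <= N)%N.
    exists N.+1; apply/asboolP; split=> // g g1 /HL gL.
    have [Q [dQ cQ]] := HN g gL g1; exists Q; split=> //; exact: leqW.
  elim: L {HL} => [|h L [N HN]]; first by exists 0%N.
  have [->|h1] := eqVneq h 1.
    by exists N => g; rewrite inE => /orP[/eqP->//|]; apply: HN.
  have [Q dQ] := rfG h (elimN eqP h1).
  exists (maxn #|Q| N) => g; rewrite inE => /orP[/eqP-> _|gL g1].
    by exists Q; rewrite leq_maxl.
  have [Q' [dQ' cQ']] := HN g gL g1; exists Q'; split=> //.
  by rewrite leq_max cQ' orbT.
case: (ex_minnP exP) => N /asboolP[N0 PN] minN.
by exists N; split=> // M M0 PM; apply: minN; apply/asboolP.
Qed.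

(* Programs for Kleene's partial recursive functions, indexed by arity. *)
Inductive recprog : nat -> Type :=
| RZero : recprog 0
| RSucc : recprog 1
| RProj k (i : 'I_k) : recprog k
| RComp m k (f : recprog m) (g : 'I_m -> recprog k) : recprog k
| RPrec k (f : recprog k) (g : recprog k.+2) : recprog k.+1
| RMin k (f : recprog k.+1) : recprog k.

(* [rec_eval p v y]: program p halts on input v with output y.  Primitive
   recursion is on the first argument, and g receives the counter, then the
   previous value, then the parameters.  [RMin f] searches for the least y
   with f(y, v) = 0, all smaller values being required to be defined. *)
Fixpoint rec_eval (k : nat) (p : recprog k) : k.-tuple nat -> nat -> Prop :=
  match p in recprog k return k.-tuple nat -> nat -> Prop with
  | RZero => fun _ y => y = 0%N
  | RSucc => fun v y => y = (thead v).+1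
  | RProj _ i => fun v y => y = tnth v i
  | RComp m _ f g => fun v y =>
      exists w : m.-tuple nat,
        (forall i : 'I_m, rec_eval (g i) v (tnth w i)) /\ rec_eval f w y
  | RPrec _ f g => fun v =>
      (fix prec (n : nat) (y : nat) {struct n} : Prop :=
         match n with
         | 0 => rec_eval f [tuple of behead v] y
         | n'.+1 => exists z : nat,
             prec n' z /\ rec_eval g [tuple of n' :: z :: behead v] y
         end) (thead v)
  | RMin _ f => fun v y =>
      rec_eval f [tuple of y :: v] 0%N /\
      (forall i : nat, (i < y)%N ->
         exists z : nat, rec_eval f [tuple of i :: v] z.+1)
  end.

Lemma rec_eval_functional (k : nat) (p : recprog k) (v : k.-tuple nat)
    (y y' : nat) :
  rec_eval p v y -> rec_eval p v y' -> y = y'.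
Proof.
elim: p v y y' => {k} [|| k i | m k f IHf g IHg | k f IHf g IHg | k f IHf] v y y' /=;
  try by move=> -> ->.
- move=> [w [Hw Hf]] [w' [Hw' Hf']].
  have Ew : w = w' by apply: eq_from_tnth => i; apply: IHg (Hw i) (Hw' i).
  by move: Hf'; rewrite -Ew; apply: IHf.
- elim: (thead v) y y' => [|n IHn] y y'; first exact: IHf.
  by move=> [z [Hz Hy]] [z' [/(IHn _ _ Hz) <- Hy']]; apply: IHg Hy Hy'.
move=> [H0 Hl] [H0' Hl']; case: (ltngtP y y') => // lt.
  by have [z /(IHf _ _ _ H0)] := Hl' _ lt.
by have [z /(IHf _ _ _ H0')] := Hl _ lt.
Qed.

Definition computable (f : nat -> nat) : Prop :=
  exists p : recprog 1, forall n : nat, rec_eval p [tuple n] (f n).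

(* Main.v *)
From HB Require Import structures.
Require Import Defs.
From mathcomp Require Import all_boot all_fingroup finmap.
From mathcomp Require Import zify.
From mathcomp Require Import boolp.

Set Implicit Arguments.
Unset Strict Implicit.
Unset Printing Implicit Defensive.

(** The trivial words of a finitely presented group are recursively enumerable:
    w is trivial iff, for L large, every set of words with code below L that
    contains the empty word and is invariant under inserting or deleting a relator
    (as long as codes stay below L) contains w.  Being nontrivial in some quotient
    of order at most N is decidable by enumerating multiplication tables.  By
    residual finiteness, a search for L therefore ends with every word of length at
    most n over X either proved trivial or detected in order at most L.  This
    decides which of these words are trivial, and F(n) is then the least N such
    that all the others are detected in order at most N. *)

(* Environments are sequences, and f only matters on those of length k: a variable
   is [head 0 (iter i behead v)], so that passing under a binder (i :: v) is a
   conversion. *)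
Definition recursive (k : nat) (f : seq nat -> nat) : Prop :=
  exists p : recprog k, forall v : k.-tuple nat, rec_eval p v (f v).

(** * Closure properties of total recursive functions *)

Lemma recursive_ext k (f g : seq nat -> nat) :
  (forall v, f v = g v) -> recursive k f -> recursive k g.
Proof. by move=> fg [p pP]; exists p => v; rewrite -fg. Qed.

Lemma recursive_var k i :
  i < k -> recursive k (fun v => head 0 (iter i behead v)).
Proof.
move=> ik; exists (RProj (Ordinal ik)) => v /=.
suff -> : iter i behead v = drop i v by rewrite (tnth_nth 0) -nth0 nth_drop addn0.
by elim: i {ik} => [|i /= ->]; rewrite ?drop0 // -drop1 drop_drop add1n.
Qed.

Lemma recursive_comp k (gs : seq (seq nat -> nat)) f :
  recursive (size gs) f ->
  (forall i, i < size gs -> recursive k (nth (fun _ => 0) gs i)) ->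
  recursive k (fun v => f [seq g v | g <- gs]).
Proof.
move=> [p pP] gsP.
(* [recursive] only asserts that each program exists; as the index set is finite, the programs can
   be collected into the one function that [RComp] takes. *)
have [q qP] : exists q : 'I_(size gs) -> recprog k, forall i (v : k.-tuple nat),
    rec_eval (q i) v (nth (fun _ => 0) gs i v).
  suff: forall i : 'I_(size gs), exists q, forall v : k.-tuple nat,
      rec_eval q v (nth (fun _ => 0) gs i v) by exact: fin_all_exists.
  by move=> i; exact: gsP.
exists (RComp p q) => v /=; exists (map_tuple (fun g : seq nat -> nat => g v) (in_tuple gs)).
split=> [i|]; last exact: pP.
by rewrite tnth_map (tnth_nth (fun _ => 0)); apply: qP.
Qed.

Lemma recursive_comp1 k f a :
  recursive 1 (fun v => f (head 0 v)) ->
  recursive k a -> recursive k (fun v => f (a v)).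
Proof.
by move=> rf ra; apply: (recursive_comp (gs := [:: a]) rf); case.
Qed.

Lemma recursive_comp2 k f a b :
  recursive 2 (fun v => f (head 0 v) (head 0 (behead v))) ->
  recursive k a -> recursive k b -> recursive k (fun v => f (a v) (b v)).
Proof.
by move=> rf ra rb; apply: (recursive_comp (gs := [:: a; b]) rf); do 2?case.
Qed.

Lemma recursive_comp3 k f a b c :
  recursive 3 (fun v => f (head 0 v) (head 0 (behead v))
                          (head 0 (behead (behead v)))) ->
  recursive k a -> recursive k b -> recursive k c ->
  recursive k (fun v => f (a v) (b v) (c v)).
Proof.
move=> rf ra rb rc.
by apply: (recursive_comp (gs := [:: a; b; c]) rf); do 3?case.
Qed.

Lemma recursive_succ k a : recursive k a -> recursive k (fun v => (a v).+1).
Proof. by apply: recursive_comp1; exists RSucc => -[[|x []] ?]. Qed.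

Lemma recursive_const k c : recursive k (fun=> c).
Proof.
elim: c => [|c IHc]; last exact: recursive_succ.
apply: (recursive_comp (gs := [::]) (f := fun=> 0)) => //.
by exists RZero.
Qed.

Lemma recursive_iteri k n x (F : nat -> nat -> seq nat -> nat) :
  recursive k n -> recursive k x ->
  recursive k.+2 (fun v => F (head 0 v) (head 0 (behead v)) (behead (behead v))) ->
  recursive k (fun v => iteri (n v) (fun i a => F i a v) (x v)).
Proof.
(* [RPrec] recurses on its first argument, so the bound is prepended to the parameters, which are
   passed on by projections. *)
move=> [pn nP] [px xP] [pF FP].
pose q (i : 'I_k.+1) := if unlift ord0 i is Some j then RProj j else pn.
exists (RComp (RPrec px pF) q) => v /=; exists [tuple of n v :: v]; split.
  move=> i; rewrite /q; case: unliftP => [j|] -> /=; first by rewrite tnthS.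
  by rewrite tnth0.
have prec (u : k.+1.-tuple nat) : rec_eval (RPrec px pF) u
    (iteri (thead u) (fun i a => F i a (behead u)) (x (behead u))).
  rewrite /=; elim: (thead u).
    exact: (xP [tuple of behead u]).
  by move=> m IHm; exists (iteri m (fun i a => F i a (behead u)) (x (behead u))).
exact: (prec [tuple of n v :: v]).
Qed.

Lemma recursive_pred k a : recursive k a -> recursive k (fun v => (a v).-1).
Proof.
apply: recursive_comp1.
apply: (@recursive_ext _ (fun v => iteri (head 0 v) (fun i _ => i) 0)).
  by move=> v; case: (head 0 v).
apply: (recursive_iteri (F := fun i _ _ => i)); try exact: recursive_const.
  exact: (@recursive_var _ 0).
exact: (@recursive_var _ 0).
Qed.

Lemma recursive_add k a b :
  recursive k a -> recursive k b -> recursive k (fun v => a v + b v).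
Proof.
apply: recursive_comp2.
apply: (@recursive_ext _ (fun v =>
    iteri (head 0 v) (fun _ x => x.+1) (head 0 (behead v)))).
  by move=> v; elim: (head 0 v) => //= n ->.
apply: (recursive_iteri (F := fun _ x _ => x.+1)).
- exact: (@recursive_var _ 0).
- exact: (@recursive_var _ 1).
- by apply: recursive_succ; exact: (@recursive_var _ 1).
Qed.

Lemma recursive_mul k a b :
  recursive k a -> recursive k b -> recursive k (fun v => a v * b v).
Proof.
apply: recursive_comp2.
apply: (@recursive_ext _ (fun v =>
    iteri (head 0 v) (fun _ x => head 0 (behead v) + x) 0)).
  by move=> v; elim: (head 0 v) => //= n ->; rewrite mulSn.
apply: (recursive_iteri (F := fun _ x v => head 0 (behead v) + x)).
- exact: (@recursive_var _ 0).
- exact: recursive_const.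
- by apply: recursive_add; [exact: (@recursive_var _ 3)|exact: (@recursive_var _ 1)].
Qed.

Lemma recursive_sub k a b :
  recursive k a -> recursive k b -> recursive k (fun v => a v - b v).
Proof.
apply: recursive_comp2.
apply: (@recursive_ext _ (fun v =>
    iteri (head 0 (behead v)) (fun _ x => x.-1) (head 0 v))).
  by move=> v; elim: (head 0 (behead v)) => [|n /= ->]; rewrite ?subn0 // subnS.
apply: (recursive_iteri (F := fun _ x _ => x.-1)).
- exact: (@recursive_var _ 1).
- exact: (@recursive_var _ 0).
- by apply: recursive_pred; exact: (@recursive_var _ 1).
Qed.

Lemma recursive_exp k a b :
  recursive k a -> recursive k b -> recursive k (fun v => a v ^ b v).
Proof.
apply: recursive_comp2.
apply: (@recursive_ext _ (fun v =>
    iteri (head 0 (behead v)) (fun _ x => head 0 v * x) 1)).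
  by move=> v; elim: (head 0 (behead v)) => //= n ->; rewrite expnS.
apply: (recursive_iteri (F := fun _ x v => head 0 v * x)).
- exact: (@recursive_var _ 1).
- exact: recursive_const.
- by apply: recursive_mul; [exact: (@recursive_var _ 2)|exact: (@recursive_var _ 1)].
Qed.

(** Predicates are read through the coercion of [bool] to [nat], so that connectives become
    arithmetic on 0 and 1. *)
Lemma recursive_neg k (P : seq nat -> bool) :
  recursive k P -> recursive k (fun v => ~~ P v).
Proof.
move=> rP; apply: (@recursive_ext _ (fun v => 1 - P v)).
  by move=> v; case: (P v).
by apply: recursive_sub => //; exact: recursive_const.
Qed.

Lemma recursive_and k (P Q : seq nat -> bool) :
  recursive k P -> recursive k Q -> recursive k (fun v => P v && Q v).
Proof.
move=> rP rQ; apply: (@recursive_ext _ (fun v => P v * Q v)).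
  by move=> v; case: (P v); case: (Q v).
exact: recursive_mul.
Qed.

Lemma recursive_or k (P Q : seq nat -> bool) :
  recursive k P -> recursive k Q -> recursive k (fun v => P v || Q v).
Proof.
move=> rP rQ; apply: (@recursive_ext _ (fun v => ~~ (~~ P v && ~~ Q v))).
  by move=> v; case: (P v); case: (Q v).
by apply/recursive_neg/recursive_and; apply: recursive_neg.
Qed.

Lemma recursive_implies k (P Q : seq nat -> bool) :
  recursive k P -> recursive k Q -> recursive k (fun v => P v ==> Q v).
Proof.
move=> rP rQ; apply: (@recursive_ext _ (fun v => ~~ P v || Q v)).
  by move=> v; case: (P v); case: (Q v).
by apply: recursive_or => //; apply: recursive_neg.
Qed.

Lemma recursive_leq k a b :
  recursive k a -> recursive k b -> recursive k (fun v => a v <= b v).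
Proof.
move=> ra rb; apply: (@recursive_ext _ (fun v => 1 - (a v - b v))).
  by move=> v; rewrite /leq; case: (a v - b v).
by apply: recursive_sub; [exact: recursive_const|exact: recursive_sub].
Qed.

Lemma recursive_eqn k a b :
  recursive k a -> recursive k b -> recursive k (fun v => a v == b v).
Proof.
move=> ra rb; apply: (@recursive_ext _ (fun v => (a v <= b v) && (b v <= a v))).
  by move=> v; rewrite -eqn_leq.
by apply: recursive_and; apply: recursive_leq.
Qed.

(** * Bounded quantifiers and unbounded search *)

Definition all_below (n : nat) (P : nat -> bool) : bool := all P (iota 0 n).
Definition has_below (n : nat) (P : nat -> bool) : bool := has P (iota 0 n).

Lemma all_belowP n (P : nat -> bool) :
  reflect (forall i, i < n -> P i) (all_below n P).
Proof.
by apply: (iffP allP) => nP i; have := nP i; rewrite mem_iota.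
Qed.

Lemma has_belowP n (P : nat -> bool) :
  reflect (exists2 i, i < n & P i) (has_below n P).
Proof.
by apply: (iffP hasP) => -[i]; exists i; rewrite ?mem_iota // in p *.
Qed.

Lemma recursive_all_below k n (P : nat -> seq nat -> bool) :
  recursive k n -> recursive k.+1 (fun v => P (head 0 v) (behead v)) ->
  recursive k (fun v => all_below (n v) (fun i => P i v)).
Proof.
move=> rn rP.
apply: (@recursive_ext _ (fun v => iteri (n v) (fun i x => P i v * x) 1)).
  move=> v; elim: (n v) => // m IHm; rewrite [LHS]/= IHm /all_below.
  rewrite -[in RHS]addn1 iotaD all_cat andbC /= andbT add0n.
  by case: (P _ _); case: (all _ _).
apply: (recursive_iteri (F := fun i x v => P i v * x)) => //.
  exact: recursive_const.
apply: recursive_mul; last exact: (@recursive_var _ 1).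
(* The iteration step also receives the accumulator, in position 1; [h] skips it. *)
case: rP => p pP; pose h (i : 'I_k.+1) : recprog k.+2 :=
  if unlift ord0 i is Some j then RProj (lift ord0 (lift ord0 j)) else RProj ord0.
exists (RComp p h) => v /=; exists [tuple of head 0 v :: behead (behead v)].
split; last exact: pP.
move=> i; rewrite /h; case: unliftP => [j|] -> /=.
  by rewrite !(tnth_nth 0) /= -!nth_behead.
by rewrite tnth0 (tnth_nth 0) nth0.
Qed.

Lemma recursive_has_below k n (P : nat -> seq nat -> bool) :
  recursive k n -> recursive k.+1 (fun v => P (head 0 v) (behead v)) ->
  recursive k (fun v => has_below (n v) (fun i => P i v)).
Proof.
move=> rn rP.
apply: (@recursive_ext _ (fun v => ~~ all_below (n v) (fun i => ~~ P i v))).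
  move=> v; congr (nat_of_bool _).
  by rewrite /has_below -[has _ _]negbK -all_predC.
apply/recursive_neg/(recursive_all_below (P := fun i v => ~~ P i v)) => //.
exact: recursive_neg.
Qed.

Lemma recursive_all_seq T k (s : seq T) (P : T -> seq nat -> bool) :
  (forall x, recursive k (P x)) -> recursive k (fun v => all (fun x => P x v) s).
Proof.
move=> rP; elim: s => [|x s IHs]; first exact: recursive_const.
exact: recursive_and.
Qed.

(** [RMin] looks for a zero, and the negation of [P] is 0 exactly where [P] holds. *)
Lemma recursive_min k (P : nat -> seq nat -> bool) (f : seq nat -> nat) :
  recursive k.+1 (fun v => P (head 0 v) (behead v)) ->
  (forall v : k.-tuple nat, P (f v) v) ->
  (forall (v : k.-tuple nat) i, i < f v -> ~~ P i v) ->
  recursive k f.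
Proof.
move=> /recursive_neg[p pP] Pf minf; exists (RMin p) => v /=; split.
  by have := pP [tuple of f v :: v]; rewrite /= Pf.
move=> i ltif; exists 0; have := pP [tuple of i :: v].
by rewrite /= minf.
Qed.

Lemma recursive_nth k (s : seq nat) a :
  recursive k a -> recursive k (fun v => nth 0 s (a v)).
Proof.
elim: s a => [|x s IHs] a ra.
  by apply: (@recursive_ext _ (fun=> 0)) (recursive_const _ _) => v; rewrite nth_nil.
apply: (@recursive_ext _ (fun v =>
  (a v == 0) * x + ~~ (a v == 0) * nth 0 s (a v).-1)).
  by move=> v; case: (a v) => [|n] /=; rewrite ?mul1n ?addn0.
have r0 : recursive k (fun v => a v == 0).
  by apply: recursive_eqn => //; exact: recursive_const.
apply: recursive_add; apply: recursive_mul => //; try exact: recursive_const.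
  exact: recursive_neg.
exact/IHs/recursive_pred.
Qed.

Ltac recursive_variable k :=
  lazymatch k with
  | S ?n => first [apply: (@recursive_var _ n); exact isT | recursive_variable n]
  end.

(* The bounded quantifiers come before the connectives, which would otherwise match
   after unfolding of iota. *)
Ltac recursive_step := first
  [ assumption
  | lazymatch goal with |- recursive ?k _ => recursive_variable k end
  | apply: recursive_const
  | apply: recursive_all_below | apply: recursive_has_below
  | apply: recursive_succ | apply: recursive_pred | apply: recursive_add
  | apply: recursive_sub | apply: recursive_mul | apply: recursive_exp
  | apply: recursive_neg | apply: recursive_and | apply: recursive_or
  | apply: recursive_implies | apply: recursive_leq | apply: recursive_eqn
  | apply: recursive_all_seq => ? | apply: recursive_nth ].

Ltac prove_recursive := repeat recursive_step.

(** * Division and digits *)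

(** The quotient counts the positive multiples of [d] up to [m]; the factor [0 < d] covers the
    convention for division by 0. *)
Lemma divn_iteri m d :
  m %/ d = (0 < d) * iteri m (fun i a => a + (d * i.+1 <= m)) 0.
Proof.
have [->|d0] := posnP d; first by rewrite divn0.
(* For the induction: after n steps the count is the minimum of n and the quotient. *)
rewrite mul1n -[LHS](minn_idPl (leq_div m d)).
elim: {2 3}m => [|n IHn] /=; first by rewrite minn0.
rewrite -IHn mulnC -leq_divRL //; lia.
Qed.

Lemma recursive_div k a b :
  recursive k a -> recursive k b -> recursive k (fun v => a v %/ b v).
Proof.
apply: recursive_comp2; apply: (@recursive_ext _ (fun v => (0 < head 0 (behead v)) *
    iteri (head 0 v) (fun i a => a + (head 0 (behead v) * i.+1 <= head 0 v)) 0)).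
  by move=> v; rewrite divn_iteri.
prove_recursive.
by apply: (recursive_iteri (F := fun i a v =>
  a + (head 0 (behead v) * i.+1 <= head 0 v))); prove_recursive.
Qed.

Lemma recursive_mod k a b :
  recursive k a -> recursive k b -> recursive k (fun v => a v %% b v).
Proof.
move=> ra rb; apply: (@recursive_ext _ (fun v => a v - a v %/ b v * b v)).
  by move=> v; rewrite {1}(divn_eq (a v) (b v)) addKn.
by prove_recursive; apply: recursive_div.
Qed.

(** Through its digits, a number below [b ^ n] codes a map from [0, n) to [0, b). Sets,
    multiplication tables, letter assignments and choices of generators are all coded this way. *)
Definition digit (b c i : nat) : nat := (c %/ b ^ i) %% b.

Lemma recursive_digit k b c i :
  recursive k b -> recursive k c -> recursive k i ->
  recursive k (fun v => digit (b v) (c v) (i v)).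
Proof.
move=> rb rc ri; apply: recursive_mod => //.
by apply: recursive_div; prove_recursive.
Qed.

Lemma digits_exist b n (f : nat -> nat) :
  (forall i, i < n -> f i < b) ->
  exists2 c, c < b ^ n & forall i, i < n -> digit b c i = f i.
Proof.
elim: n f => [|n IHn] f fb; first by exists 0.
have [i ltin|c cb fc] := IHn (fun i => f i.+1); first exact: fb.
have f0 : f 0 < b by exact: fb.
exists (f 0 + b * c).
  by rewrite expnS; nia.
case=> [|i] ltin; rewrite /digit; first by rewrite divn1 addnC mulnC modnMDl modn_small.
rewrite -(fc i) // /digit expnS divnMA addnC mulnC divnMDl; last first.
  exact: leq_ltn_trans f0.
by rewrite (divn_small f0) addn0.
Qed.

(** * Words as numbers *)

(* Bijective numeration: with digits in [1, B] every number is the code of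
   exactly one word over the alphabet [0, B-1]. *)
Definition encode (B : nat) (u : seq nat) : nat := foldr (fun a x => a.+1 + B * x) 0 u.

(** The code of [a :: u] minus 1 is [a + B * encode B u]: its quotient by [B] codes the tail and its
    remainder is the first letter. *)
Definition code_behead (B x : nat) : nat := x.-1 %/ B.

Definition code_nth (B x i : nat) : nat := (iter i (code_behead B) x).-1 %% B.

(** Counts the nonempty suffixes; [x] steps are enough because a word is no longer than its code. *)
Definition code_size (B x : nat) : nat :=
  iteri x (fun i a => a + (0 < iter i (code_behead B) x)) 0.

Definition code_cat (B x y : nat) : nat := x + B ^ code_size B x * y.

Definition decode (B x : nat) : seq nat := mkseq (code_nth B x) (code_size B x).

Lemma encode_cat B u v : encode B (u ++ v) = encode B u + B ^ size u * encode B v.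
Proof.
elim: u => [|a u IHu] /=; first by rewrite mul1n.
by rewrite IHu mulnDr mulnA -expnS addnA.
Qed.

Lemma iter_code_behead B u i :
  all (gtn B) u -> iter i (code_behead B) (encode B u) = encode B (drop i u).
Proof.
elim: i u => [|i IHi] [|a u] //; rewrite iterSr.
  by move=> _; rewrite {2}/code_behead div0n -(IHi [::]).
move=> /= /andP[aB uB]; rewrite -IHi //; congr iter.
by rewrite /code_behead addSn /= addnC mulnC divnMDl ?divn_small ?addn0 //; lia.
Qed.

Lemma encode_gt0 B u : (0 < encode B u) = (0 < size u).
Proof. by case: u. Qed.

Lemma size_encode B u : 0 < B -> size u <= encode B u.
Proof. by move=> B0; elim: u => //= a u IHu; nia. Qed.

Lemma code_size_encode B u :
  0 < B -> all (gtn B) u -> code_size B (encode B u) = size u.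
Proof.
move=> B0 uB; rewrite -[RHS](minn_idPr (size_encode u B0)) /code_size.
elim: {1 3}(encode B u) => [|n IHn] /=; first by rewrite min0n.
by rewrite IHn iter_code_behead // encode_gt0 size_drop; lia.
Qed.

Lemma code_nth_encode B u i :
  all (gtn B) u -> i < size u -> code_nth B (encode B u) i = nth 0 u i.
Proof.
move=> uB iu; rewrite /code_nth iter_code_behead // (drop_nth 0) //=.
by rewrite addnC mulnC modnMDl modn_small //; exact: (all_nthP 0 uB).
Qed.

Lemma encodeK B u : 0 < B -> all (gtn B) u -> decode B (encode B u) = u.
Proof.
move=> B0 uB; rewrite /decode code_size_encode //.
apply: (@eq_from_nth _ 0); rewrite size_mkseq // => i iu.
by rewrite nth_mkseq // code_nth_encode.
Qed.

(** Dividing the predecessor by [B] splits off a letter and leaves a smaller code. Hence a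
    quantifier over numbers is one over words. *)
Lemma encode_surj B x : 0 < B -> exists2 u, all (gtn B) u & encode B u = x.
Proof.
move=> B0; elim/ltn_ind: x => -[|x] IHx; first by exists [::].
have [|u uB ux] := IHx (x %/ B); first by rewrite ltnS leq_div.
exists (x %% B :: u); rewrite /= ?ux ?uB ?ltn_mod ?B0 //.
by rewrite [in RHS](divn_eq x B); lia.
Qed.

Lemma decodeK B x : 0 < B -> encode B (decode B x) = x.
Proof. by move=> B0; have [u uB <-] := encode_surj x B0; rewrite encodeK. Qed.

Lemma code_cat_encode B u v : 0 < B -> all (gtn B) u ->
  code_cat B (encode B u) (encode B v) = encode B (u ++ v).
Proof. by move=> B0 uB; rewrite /code_cat code_size_encode // encode_cat. Qed.

Lemma all_decode B x : 0 < B -> all (gtn B) (decode B x).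
Proof. by move=> B0; have [u uB <-] := encode_surj x B0; rewrite encodeK. Qed.

Lemma decode_cat B x y : 0 < B -> decode B (code_cat B x y) = decode B x ++ decode B y.
Proof.
move=> B0; rewrite -{1}(decodeK x B0) -{1}(decodeK y B0) code_cat_encode ?all_decode //.
by rewrite encodeK // all_cat !all_decode.
Qed.

Lemma code_catP B u v w : 0 < B -> all (gtn B) u -> all (gtn B) v ->
  code_cat B (encode B u) (code_cat B (encode B v) (encode B w)) =
  encode B (u ++ v ++ w).
Proof. by move=> B0 uB vB; rewrite !code_cat_encode. Qed.

Lemma eq_iteri_below T n (f g : nat -> T -> T) x :
  (forall i, i < n -> f i =1 g i) -> iteri n f x = iteri n g x.
Proof.
elim: n => // n IHn fg /=; rewrite fg // IHn // => i ltin.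
by apply: fg; rewrite ltnW.
Qed.

(** Relates loops over positions, which are recursive, to left folds over words, which suit
    induction. *)
Lemma iteri_nth T (F : T -> nat -> T) x u :
  iteri (size u) (fun i a => F a (nth 0 u i)) x = foldl F x u.
Proof.
elim/last_ind: u => // u a IHu; rewrite size_rcons foldl_rcons /= -IHu.
rewrite nth_rcons ltnn eqxx; congr F.
by apply: eq_iteri_below => i iu y; rewrite nth_rcons iu.
Qed.

Lemma recursive_iter_code_behead B k i x : recursive k i -> recursive k x ->
  recursive k (fun v => iter (i v) (code_behead B) (x v)).
Proof.
apply: (recursive_comp2 (f := fun n => iter n (code_behead B))).
apply: (@recursive_ext _ (fun v => iteri (head 0 v) (fun _ y => y.-1 %/ B) (head 0 (behead v)))).
  by move=> v; elim: (head 0 v) => //= n ->.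
apply: (recursive_iteri (F := fun _ y _ => y.-1 %/ B)); prove_recursive.
by apply: recursive_div; prove_recursive.
Qed.

Lemma recursive_code_nth B k x i : recursive k x -> recursive k i ->
  recursive k (fun v => code_nth B (x v) (i v)).
Proof.
move=> rx ri; apply: recursive_mod; prove_recursive.
exact: recursive_iter_code_behead.
Qed.

Lemma recursive_code_size B k x :
  recursive k x -> recursive k (fun v => code_size B (x v)).
Proof.
apply: (recursive_comp1 (f := code_size B)).
apply: (recursive_iteri (F := fun i a v => a + (0 < iter i (code_behead B) (head 0 v))));
  prove_recursive.
by apply: recursive_iter_code_behead; prove_recursive.
Qed.

Lemma recursive_code_cat B k x y : recursive k x -> recursive k y ->
  recursive k (fun v => code_cat B (x v) (y v)).
Proof. by move=> rx ry; rewrite /code_cat; prove_recursive; apply: recursive_code_size. Qed.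

(** * The decision procedures *)

(* A subset of [0, L) is the set of positions of the digits 1 of some c < 2 ^ L. *)
Definition relator_closed (B : nat) (rels : seq nat) (L c : nat) : bool :=
  (digit 2 c 0 == 1) &&
  all_below L (fun p => all_below L (fun q => all (fun r =>
    (code_cat B p (code_cat B r q) < L) ==> (code_cat B p q < L) ==>
    (digit 2 c (code_cat B p (code_cat B r q)) == digit 2 c (code_cat B p q)))
    rels)).

(** For the relators of a presentation a positive answer is always right; a negative one may only
    mean that [L] is too small. *)
Definition trivial_within (B : nat) (rels : seq nat) (x L : nat) : bool :=
  (x < L) &&
  all_below (2 ^ L) (fun c => relator_closed B rels L c ==> (digit 2 c x == 1)).

(** The multiplication table on [0, m) is stored row by row in base [m]. *)
Definition table_op (m t x y : nat) : nat := digit m t (x * m + y).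

(** The digits of [q] are the images of the letters; the product starts from [e] and grows on the
    right. *)
Definition table_eval (B m t q e x : nat) : nat :=
  iteri (code_size B x) (fun i a => table_op m t a (digit m q (code_nth B x i))) e.

(* Associativity and right neutrality suffice: evaluating a word from x then gives
   x times its evaluation from e. *)
Definition table_monoid (m t e : nat) : bool :=
  all_below m (fun x => (table_op m t x e == x) &&
    all_below m (fun y => all_below m (fun z =>
      table_op m t (table_op m t x y) z == table_op m t x (table_op m t y z)))).

Definition table_detects (B : nat) (rels : seq nat) (x m t q e : nat) : bool :=
  [&& table_monoid m t e, all (fun r => table_eval B m t q e r == e) rels
    & table_eval B m t q e x != e].

(** Candidate orders are [m.+1], from 1 to [N]; the bounds on [t] and [q] leave room for every table
    and every assignment of [B] letters. *)
Definition detected_within (B : nat) (rels : seq nat) (x N : nat) : bool :=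
  has_below N (fun m => has_below (m.+1 ^ (m.+1 * m.+1)) (fun t =>
    has_below (m.+1 ^ B) (fun q => has_below m.+1 (fun e =>
      table_detects B rels x m.+1 t q e)))).

Definition product_code (B : nat) (gens : seq nat) (n c : nat) : nat :=
  iteri n (fun i a => code_cat B a (nth 0 gens (digit (size gens) c i))) 0.

(** Two bounds are kept because the first search moves both together, while the second fixes [L] and
    minimises [N]. *)
Definition all_resolved (B : nat) (rels gens : seq nat) (n L N : nat) : bool :=
  all_below (size gens ^ n) (fun c =>
    trivial_within B rels (product_code B gens n c) L ||
    detected_within B rels (product_code B gens n c) N).

(** * Recursiveness of the decision procedures *)

Ltac recursive_code_step := first
  [ recursive_step | apply: recursive_digit
  | apply: recursive_code_cat | apply: recursive_code_size
  | apply: recursive_code_nth ].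

Lemma recursive_trivial_within B rels k x L : recursive k x -> recursive k L ->
  recursive k (fun v => trivial_within B rels (x v) (L v)).
Proof.
apply: (recursive_comp2 (f := trivial_within B rels)).
rewrite /trivial_within /relator_closed.
by repeat recursive_code_step.
Qed.

Lemma recursive_table_op k m t x y :
  recursive k m -> recursive k t -> recursive k x -> recursive k y ->
  recursive k (fun v => table_op (m v) (t v) (x v) (y v)).
Proof. by move=> *; apply: recursive_digit; prove_recursive. Qed.

Lemma recursive_table_monoid k m t e :
  recursive k m -> recursive k t -> recursive k e ->
  recursive k (fun v => table_monoid (m v) (t v) (e v)).
Proof.
apply: (recursive_comp3 (f := table_monoid)); rewrite /table_monoid.
by repeat first [recursive_step | apply: recursive_table_op].
Qed.

Lemma recursive_table_eval B k m t q e x :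
  recursive k m -> recursive k t -> recursive k q -> recursive k e ->
  recursive k x ->
  recursive k (fun v => table_eval B (m v) (t v) (q v) (e v) (x v)).
Proof.
move=> rm rt rq re rx; apply: (recursive_comp (gs := [:: m; t; q; e; x])
  (f := fun v => table_eval B (head 0 v) (head 0 (behead v))
    (head 0 (behead (behead v))) (head 0 (behead (behead (behead v))))
    (head 0 (behead (behead (behead (behead v))))))); last by do 5?case.
apply: (recursive_iteri (F := fun i a v =>
  table_op (head 0 v) (head 0 (behead v)) a
    (digit (head 0 v) (head 0 (behead (behead v)))
      (code_nth B (head 0 (behead (behead (behead (behead v))))) i))));
  rewrite [size _]/=; repeat first [recursive_code_step | apply: recursive_table_op].
Qed.

Lemma recursive_detected_within B rels k x N : recursive k x -> recursive k N ->
  recursive k (fun v => detected_within B rels (x v) (N v)).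
Proof.
apply: (recursive_comp2 (f := detected_within B rels)).
rewrite /detected_within /table_detects.
by repeat first [apply: recursive_table_monoid | apply: recursive_table_eval
                | recursive_code_step].
Qed.

Lemma recursive_product_code B gens k n c : recursive k n -> recursive k c ->
  recursive k (fun v => product_code B gens (n v) (c v)).
Proof.
apply: (recursive_comp2 (f := product_code B gens)).
by apply: (recursive_iteri (F := fun i a v =>
  code_cat B a (nth 0 gens (digit (size gens) (head 0 (behead v)) i))));
  repeat recursive_code_step.
Qed.

Lemma recursive_all_resolved B rels gens k n L N :
  recursive k n -> recursive k L -> recursive k N ->
  recursive k (fun v => all_resolved B rels gens (n v) (L v) (N v)).
Proof.
apply: (recursive_comp3 (f := all_resolved B rels gens)).
rewrite /all_resolved.
by repeat first [apply: recursive_product_code | apply: recursive_trivial_within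
                | apply: recursive_detected_within | recursive_step].
Qed.

(** Two nested unbounded searches: [T n] is the least bound that resolves every product of n
    generators, and [F n] is then the least positive detection bound, with triviality still tested
    at [T n]. *)
Lemma computable_least_resolved B rels gens T F :
  (forall n, all_resolved B rels gens n (T n) (T n)) ->
  (forall n L, L < T n -> ~~ all_resolved B rels gens n L L) ->
  (forall n, (0 < F n) && all_resolved B rels gens n (T n) (F n)) ->
  (forall n N, N < F n -> ~~ ((0 < N) && all_resolved B rels gens n (T n) N)) ->
  computable F.
Proof.
move=> PT minT PF minF.
have rT k a : recursive k a -> recursive k (fun v => T (a v)).
  apply: recursive_comp1; apply: (recursive_min (P := fun L v =>
    all_resolved B rels gens (head 0 v) L L)) => [|v|v]; last 2 first.
  - exact: PT.
  - exact: minT.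
  by apply: recursive_all_resolved; prove_recursive.
suff [p pP] : recursive 1 (fun v => F (head 0 v)) by exists p => n; apply: (pP [tuple n]).
apply: (recursive_min (P := fun N v =>
    (0 < N) && all_resolved B rels gens (head 0 v) (T (head 0 v)) N)) => [|v|v].
- by repeat first [apply: recursive_all_resolved | apply: rT | recursive_step].
- exact: PF.
- exact: minF.
Qed.

(** * Correctness for finitely presented groups *)

Lemma table_eval_encode B m t q e u : 0 < B -> all (gtn B) u ->
  table_eval B m t q e (encode B u) =
  foldl (fun a d => table_op m t a (digit m q d)) e u.
Proof.
move=> B0 uB; rewrite -iteri_nth /table_eval code_size_encode //.
by apply: eq_iteri_below => i iu y; rewrite code_nth_encode.
Qed.

(** The successor keeps the base positive when [k] is 0, at the cost of one spare letter. *)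
Definition alphabet_size (k : nat) : nat := (size (enum {: 'I_k * bool})).+1.

Definition letter_code k (a : 'I_k * bool) : nat := index a (enum {: 'I_k * bool}).

Definition word_code k (w : word k) : nat :=
  encode (alphabet_size k) [seq letter_code a | a <- w].

(** With the free cancellations among the relators, [WE_cancel] and [WE_relator] are both insertions
    or deletions of a relator. *)
Definition all_relators k (R : seq (word k)) : seq (word k) :=
  R ++ [seq [:: a; (a.1, ~~ a.2)] | a <- enum {: 'I_k * bool}].

Lemma letter_codeP k (w : word k) :
  all (gtn (alphabet_size k)) [seq letter_code a | a <- w].
Proof. by apply/allP => _ /mapP[a _ ->]; rewrite /= ltnS ltnW // index_mem mem_enum. Qed.

Lemma word_code_cat3 k (u v w : word k) :
  code_cat (alphabet_size k) (word_code u)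
    (code_cat (alphabet_size k) (word_code v) (word_code w)) =
  word_code (u ++ v ++ w).
Proof. by rewrite code_catP ?letter_codeP // -!map_cat. Qed.

Lemma word_code_cat k (u v : word k) :
  code_cat (alphabet_size k) (word_code u) (word_code v) = word_code (u ++ v).
Proof. by rewrite code_cat_encode ?letter_codeP // -map_cat. Qed.

(* The conclusion is stable under insertion and deletion of relators in w, hence
   under word_equiv. *)
Lemma trivial_within_complete k (R : seq (word k)) w :
  word_equiv R w [::] ->
  exists L0, forall L, L0 <= L ->
    trivial_within (alphabet_size k) [seq word_code r | r <- all_relators R]
      (word_code w) L.
Proof.
set B := alphabet_size k; set rels := map _ _.
pose P (u : word k) := exists L0, forall L, L0 <= L -> trivial_within B rels (word_code u) L.
have insP (p q r : word k) : r \in all_relators R -> P (p ++ r ++ q) <-> P (p ++ q).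
  move=> rR.
  suff step (x y : word k) : ((x = p ++ r ++ q /\ y = p ++ q) \/ (x = p ++ q /\ y = p ++ r ++ q)) ->
      P x -> P y by split; apply: step; [left | right].
  move=> xy [L0 xL].
  (* The bound exceeds all four codes, so the closure condition applies to [p] and [q], and both
     words lie below [L]. *)
  exists (L0 + (word_code p + word_code q + word_code x + word_code y).+1) => L ltL.
  have /andP[_ /all_belowP xT] : trivial_within B rels (word_code x) L by apply: xL; lia.
  apply/andP; split; first lia; apply/all_belowP => c cL; apply/implyP => closed.
  have := xT _ cL; rewrite closed /= => /eqP x1.
  move: closed => /andP[_ /all_belowP/(_ (word_code p))].
  move=> /(_ ltac:(lia)) /all_belowP/(_ (word_code q) ltac:(lia)).
  move=> /allP/(_ (word_code r) (map_f _ rR)).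
  rewrite word_code_cat3 word_code_cat.
  have [-> ->] : word_code (p ++ r ++ q) < L /\ word_code (p ++ q) < L.
    by case: xy => -[xE yE]; rewrite -xE -yE; split; lia.
  by rewrite /= => /eqP E; case: xy x1 => -[-> ->] x1; apply/eqP; rewrite ?E // -E.
(* Stating the equivalence in every context lets the concatenation case change one factor at a
   time. *)
have equivP u v : word_equiv R u v -> forall p q, P (p ++ u ++ q) <-> P (p ++ v ++ q).
  elim=> {u v} [u|u v _ IH|u v w' _ IHu _ IHv|u u' v v' _ IHu _ IHv|i b|r rR] p q.
  - by [].
  - by rewrite IH.
  - by rewrite IHu.
  - by rewrite -!catA IHu catA IHv -catA.
  - apply: insP; rewrite mem_cat; apply/orP; right.
    by apply/mapP; exists (i, b); rewrite ?mem_enum.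
  - by apply: insP; rewrite mem_cat rR.
move=> /equivP/(_ [::] [::]); rewrite cats0 /= => -[_]; apply.
(* The empty word has code 0, which every closed set contains. *)
exists 1 => L L0; apply/andP; split=> //; apply/all_belowP => c _.
by apply/implyP => /andP[].
Qed.

(** * Soundness of the triviality test *)

Section Soundness.

Variables (G : groupType) (k : nat) (s : 'I_k -> G).

(** The default 1 gives the spare letter a value, so that every number has a value in [G]. *)
Definition letter_value (d : nat) : G :=
  (nth 1 [seq word_eval s [:: a] | a <- enum {: 'I_k * bool}] d)%g.

Lemma word_eval_cat u v : (word_eval s (u ++ v) = word_eval s u * word_eval s v)%g.
Proof. exact: big_cat. Qed.

Lemma letter_codeK a : letter_value (letter_code a) = word_eval s [:: a].
Proof.
by rewrite /letter_value (nth_map a) ?nth_index ?index_mem ?mem_enum.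
Qed.

Definition code_value (x : nat) : G :=
  (\prod_(d <- decode (alphabet_size k) x) letter_value d)%g.

Lemma word_codeK w : code_value (word_code w) = word_eval s w.
Proof.
rewrite /code_value encodeK ?letter_codeP // big_map.
elim: w => [|a w IHw]; rewrite ?big_nil //; first by rewrite /word_eval big_nil.
by rewrite big_cons IHw letter_codeK -word_eval_cat.
Qed.

Lemma all_relators_eval R : (forall r, r \in R -> word_eval s r = 1%g) ->
  forall r, r \in all_relators R -> word_eval s r = 1%g.
Proof.
move=> R1 r; rewrite mem_cat => /orP[/R1 //|/mapP[[i b] _ ->]].
by rewrite /word_eval !big_cons big_nil mulg1; case: b; rewrite ?mulgV ?mulVg.
Qed.

(** The codes below [L] whose value in [G] is 1 form a closed set, which must therefore contain the
    code of [w]. *)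
Lemma trivial_within_sound R w L :
  (forall r, r \in R -> word_eval s r = 1%g) ->
  trivial_within (alphabet_size k) [seq word_code r | r <- all_relators R]
    (word_code w) L ->
  word_eval s w = 1%g.
Proof.
move=> /all_relators_eval R1 /andP[ltwL /all_belowP trivw].
have [i _|c cL cE] := @digits_exist 2 L (fun i => `[< code_value i = 1%g >]).
  by case: `[< _ >].
have := trivw c cL; rewrite cE // word_codeK.
rewrite implybE => /orP[/negP[]|]; last by case: asboolP.
have value_cat x y :
    (code_value (code_cat (alphabet_size k) x y) = code_value x * code_value y)%g.
  by rewrite /code_value decode_cat // big_cat.
apply/andP; split.
  rewrite cE; last lia; case: asboolP => // -[].
  by rewrite /code_value /decode big_nil.
apply/all_belowP => p pL; apply/all_belowP => q qL; apply/allP => _ /mapP[r rR ->].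
apply/implyP => l1; apply/implyP => l2; rewrite !cE // !value_cat word_codeK R1 //.
by rewrite mul1g.
Qed.

End Soundness.

(** * Finite quotients and multiplication tables *)

(** Numbering the elements of [Q] turns its product into a table [t] and the images of the letters
    into an assignment [q]. *)
Lemma detected_within_complete (G : groupType) k (R : seq (word k)) (s : 'I_k -> G)
    w N (Q : finGroupType) :
  (forall r, r \in R -> word_eval s r = 1%g) ->
  detected_by Q (word_eval s w) -> #|Q| <= N ->
  detected_within (alphabet_size k) [seq word_code r | r <- all_relators R]
    (word_code w) N.
Proof.
move=> /all_relators_eval R1 [phi [_ phiw]] QN.
have phi1 : phi 1%g = 1%g by apply: (mulgI (phi 1%g)); rewrite -gmulfM !mulg1.
pose m := #|Q|; pose val := nth (1%g : Q) (enum Q).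
pose idx (x : Q) := index x (enum Q).
have valK x : val (idx x) = x by rewrite /val nth_index ?mem_enum.
have idxK i : i < m -> idx (val i) = i.
  by move=> im; rewrite /idx index_uniq -?cardE ?enum_uniq.
have idx_lt x : idx x < m by rewrite /m cardE index_mem mem_enum.
have m0 : 0 < m by exact: leq_ltn_trans (idx_lt 1%g).
have [i _|t t_lt tE] := @digits_exist m (m * m) (fun i => idx (val (i %/ m) * val (i %% m))%g).
  exact: idx_lt.
have [i _|q q_lt qE] := @digits_exist m (alphabet_size k) (fun i => idx (phi (letter_value s i))).
  exact: idx_lt.
have opE i j : i < m -> j < m -> table_op m t i j = idx (val i * val j)%g.
  move=> im jm; rewrite /table_op tE; last nia.
  by rewrite divnMDl // divn_small // addn0 modnMDl modn_small.
have evalE u : table_eval (alphabet_size k) m t q (idx 1%g) (word_code u) =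
    idx (phi (word_eval s u)).
  rewrite table_eval_encode ?letter_codeP //.
  elim/last_ind: u => [|u a IHu]; first by rewrite /word_eval big_nil phi1.
  rewrite map_rcons foldl_rcons IHu qE; last first.
    by have := letter_codeP [:: a]; rewrite /= andbT.
  by rewrite opE // !valK letter_codeK -gmulfM -word_eval_cat cats1.
have mS : m.-1.+1 = m by rewrite prednK.
apply/has_belowP; exists m.-1; first lia.
rewrite mS; apply/has_belowP; exists t => //.
apply/has_belowP; exists q => //; apply/has_belowP; exists (idx 1%g) => //.
apply/and3P; split.
- apply/all_belowP => x xm; apply/andP; split.
    by rewrite opE // valK mulg1 idxK.
  apply/all_belowP => y ym; apply/all_belowP => z zm.
  by rewrite !opE // !valK mulgA.
- by apply/allP => _ /mapP[r rR ->]; rewrite evalE R1 // phi1.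
- by apply/eqP; rewrite evalE => /(congr1 val); rewrite !valK.
Qed.

(* The words act on the table by right translations, and a right translation is
   determined by its value at e, so the image of G in Sym(m) has at most m elements. *)
Lemma detected_within_sound (G : groupType) k (R : seq (word k)) (s : 'I_k -> G) w N :
  presented_by R s ->
  detected_within (alphabet_size k) [seq word_code r | r <- all_relators R]
    (word_code w) N ->
  exists Q : finGroupType, detected_by Q (word_eval s w) /\ #|Q| <= N.
Proof.
move=> [s_surj s_equiv] /has_belowP[n ltnN] /has_belowP[t _] /has_belowP[q _].
move=> /has_belowP[e0 e0n] /and3P[/all_belowP tableP /allP relsP /eqP detw].
set m := n.+1 in e0n tableP relsP detw.
pose op (x y : 'I_m) : 'I_m := Ordinal (ltn_pmod (t %/ m ^ (x * m + y)) (ltn0Sn n)).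
pose gen (a : 'I_k * bool) : 'I_m :=
  Ordinal (ltn_pmod (q %/ m ^ letter_code a) (ltn0Sn n)).
pose e : 'I_m := Ordinal e0n.
pose run (u : word k) (x : 'I_m) : 'I_m := foldl (fun x a => op x (gen a)) x u.
have opE x : op x e = x.
  by have /andP[/eqP xe _] := tableP x (ltn_ord x); apply: val_inj.
have opA x y z : op (op x y) z = op x (op y z).
  have /andP[_ /all_belowP/(_ y (ltn_ord y))] := tableP x (ltn_ord x).
  by move=> /all_belowP/(_ z (ltn_ord z))/eqP xyz; apply: val_inj.
have run_op u x : run u x = op x (run u e).
  elim/last_ind: u => [|u a IHu]; first by rewrite opE.
  by rewrite /run !foldl_rcons -/(run u x) -/(run u e) IHu opA.
have run_cat u v x : run (u ++ v) x = run v (run u x) by rewrite /run foldl_cat.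
have run_eval u : table_eval (alphabet_size k) m t q e0 (word_code u) = run u e.
  rewrite table_eval_encode ?letter_codeP // /run.
  elim/last_ind: u => // u a IHu.
  by rewrite map_rcons !foldl_rcons IHu.
(* A relator fixes [e] by the test, hence every [x], because its action is right multiplication by
   its value at [e]. *)
have run_rel r x : r \in all_relators R -> run r x = x.
  move=> rR; rewrite run_op -[RHS]opE; congr op; apply: ord_inj.
  by rewrite -run_eval; apply/eqP/relsP/map_f.
have run_equiv u v : word_equiv R u v -> run u =1 run v.
  elim=> {u v} [u|u v _ IH|u v w' _ IHu _ IHv|u u' v v' _ IHu _ IHv|i b|r rR] x //.
  - by rewrite IHu IHv.
  - by rewrite !run_cat IHu IHv.
  - apply: run_rel; rewrite mem_cat; apply/orP; right.
    by apply/mapP; exists (i, b); rewrite ?mem_enum.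
  - by apply: run_rel; rewrite mem_cat rR.
have [wd wdK] := choice s_surj.
have run_wd u : run (wd (word_eval s u)) =1 run u.
  by apply: run_equiv; apply/s_equiv.
have run1 : run (wd 1%g) =1 id.
  by move=> x; have := run_wd [::] x; rewrite {1}/word_eval big_nil.
have runM g h x : run (wd (g * h)%g) x = run (wd h) (run (wd g) x).
  by rewrite -run_cat -[RHS]run_wd word_eval_cat !wdK.
(* The word chosen for the inverse of [g] undoes the action of the word chosen for [g]. *)
have run_inj g : injective (run (wd g)).
  by apply: (can_inj (g := run (wd g^-1%g))) => x; rewrite -runM mulgV run1.
pose rho g : {perm 'I_m} := perm (@run_inj g).
have rhoE g x : rho g x = run (wd g) x by rewrite permE.
(* Permutations compose from left to right, as words act, so [rho] is a morphism and not an
   antimorphism. *)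
have rhoM g h : rho (g * h)%g = (rho g * rho h)%g.
  by apply/permP => x; rewrite permM !rhoE runM.
pose H := [set p : {perm 'I_m} | `[< exists g, rho g = p >]]%SET.
have rhoH g : rho g \in H by rewrite inE; apply/asboolP; exists g.
have HP p : p \in H -> exists g, rho g = p by rewrite inE => /asboolP.
have gH : group_set H.
  apply/group_setP; split.
    by rewrite inE; apply/asboolP; exists 1%g; apply/permP => x; rewrite rhoE run1 perm1.
  by move=> _ _ /HP[g <-] /HP[h <-]; rewrite -rhoM.
pose K := Group gH.
(* Restricting the codomain to the image makes the morphism surjective, as detection demands. *)
pose phi g : subg_of K := subg K (rho g).
have phiM : {morph phi : g h / (g * h)%g}.
  by move=> g h; rewrite /phi rhoM subgM.
exists (subg_of K); split; last first.
  rewrite card_sub.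
  have inj_e : {in H &, injective (fun p : {perm 'I_m} => p e)}.
    move=> _ _ /HP[g <-] /HP[h <-]; rewrite !rhoE => ghe.
    by apply/permP => x; rewrite !rhoE run_op ghe -run_op.
  rewrite -[#|_|](card_in_imset inj_e) (leq_trans (max_card _)) // card_ord.
  exact: ltnN.
pose phi_mul := isMultiplicative.Build G (subg_of K) phi phiM.
pose f : {multiplicative G -> subg_of K} := HB.pack phi phi_mul.
exists f; split.
  move=> x; have /HP[g gx] := valP x; exists g.
  by apply: val_inj; rewrite /= /phi gx sgvalK.
move=> /(congr1 sgval); rewrite subgK // => rho1.
by apply: detw; rewrite run_eval -run_wd -rhoE rho1 perm1.
Qed.

(** * Balls of the word metric *)

(** Including 1 makes the ball of radius n the set of products of exactly n letters. *)
Definition letters_of (G : groupType) (X : {fset G}) : seq G :=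
  (1 :: enum_fset X ++ [seq x^-1 | x <- enum_fset X])%g.

Lemma word_length_le_letters (G : groupType) (X : {fset G}) n (f : nat -> nat) :
  word_length_le X n (\prod_(0 <= i < n) nth 1 (letters_of X) (f i))%g.
Proof.
elim: n => [|n [u [un uX prodE]]].
  by exists [::]; rewrite !big_nil.
rewrite big_nat_recr //= prodE; set x := nth _ _ _.
have [->|x1] := eqVneq x 1%g; first by exists u; rewrite mulg1 leqW.
exists (rcons u x); rewrite size_rcons ltnS un big_rcons; split=> //.
rewrite all_rcons uX andbT.
have [xlt|] := ltnP (f n) (size (letters_of X)); last first.
  by move=> /(nth_default 1%g) x1'; rewrite /x x1' eqxx in x1.
have := mem_nth 1%g xlt; rewrite -/x inE (negPf x1) mem_cat /=.
by case/orP=> [->|/mapP[y yX ->]] //; rewrite invgK yX orbT.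
Qed.

(** The word is padded with 1 up to length [n], and the digits of [c] are the indices of its
    letters. *)
Lemma letters_word_length_le (G : groupType) (X : {fset G}) n g :
  word_length_le X n g -> exists2 c, c < size (letters_of X) ^ n &
    g = (\prod_(0 <= i < n) nth 1 (letters_of X) (digit (size (letters_of X)) c i))%g.
Proof.
move=> [u [un uX ->]].
have uL i : nth 1%g u i \in letters_of X.
  have [iu|/(nth_default 1%g)->] := ltnP i (size u); last exact: mem_head.
  have := allP uX _ (mem_nth 1%g iu); rewrite inE mem_cat => /orP[->|xX].
    by rewrite orbT.
  by rewrite -{3}[nth _ _ _]invgK map_f ?orbT.
have [i _|c cn cE] := @digits_exist (size (letters_of X)) n
    (fun i => index (nth 1%g u i) (letters_of X)).
  by rewrite index_mem.
exists c => //; rewrite (big_nth 1%g) (big_cat_nat (n := size u) _ un) //=.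
rewrite [X in (_ * X)%g]big1_seq ?mulg1; last first.
  move=> i /andP[_]; rewrite mem_index_iota => /andP[ui ltin].
  by rewrite cE // nth_index // nth_default.
apply: eq_big_nat => i /= iu.
by rewrite cE ?nth_index //; apply: leq_trans un.
Qed.

Lemma product_code_word (G : groupType) k (s : 'I_k -> G) (wd : G -> word k)
    (xs : seq G) n c :
  (forall g, word_eval s (wd g) = g) -> 0 < size xs ->
  exists2 w, product_code (alphabet_size k) [seq word_code (wd x) | x <- xs] n c =
      word_code w
    & word_eval s w = (\prod_(0 <= i < n) nth 1 xs (digit (size xs) c i))%g.
Proof.
move=> wdK xs0; rewrite /product_code size_map.
elim: n => [|n [w wE wV]].
  by exists [::]; rewrite // /word_eval !big_nil.
set x := nth 1%g xs (digit (size xs) c n).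
exists (w ++ wd x).
  by rewrite /= wE (nth_map 1%g) ?ltn_pmod // word_code_cat.
by rewrite big_nat_recr //= word_eval_cat wV wdK.
Qed.

(** * Computation of the growth function *)

Theorem proposition1 (G : groupType) (hfp : finitely_presented G)
    (hrf : residually_finite G) (X : {fset G}) (hX : generates X) :
  computable (rf_growth X).
Proof.
have [k [R [s sP]]] := hfp.
have [s_surj s_equiv] := sP.
(* The chosen words enter the algorithm only through the finite list [gens] of constants. *)
have [wd wdK] := choice s_surj.
have evalR r : r \in R -> word_eval s r = 1%g.
  move=> rR; have : word_eval s r = word_eval s [::] by apply/s_equiv/WE_relator.
  by rewrite [RHS]big_nil.
pose B := alphabet_size k.
pose rels := [seq word_code r | r <- all_relators R].
pose gens := [seq word_code (wd x) | x <- letters_of X].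
have size_gens : size gens = size (letters_of X) by rewrite size_map.
pose elt n c := (\prod_(0 <= i < n) nth 1 (letters_of X) (digit (size gens) c i))%g.
have codeP n c : exists2 w, product_code B gens n c = word_code w & word_eval s w = elt n c.
  by rewrite /elt size_gens; apply: product_code_word.
have trivial_sound n c L : trivial_within B rels (product_code B gens n c) L -> elt n c = 1%g.
  by have [w -> <-] := codeP n c; apply: trivial_within_sound.
have trivial_complete n c : elt n c = 1%g -> exists L0, forall L, L0 <= L ->
    trivial_within B rels (product_code B gens n c) L.
  have [w -> <-] := codeP n c => w1; apply: trivial_within_complete.
  by apply/s_equiv; rewrite w1 /word_eval big_nil.
have detectedP n c N : detected_within B rels (product_code B gens n c) N <->
    exists Q : finGroupType, detected_by Q (elt n c) /\ #|Q| <= N.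
  have [w -> <-] := codeP n c; split; first exact: detected_within_sound.
  by case=> Q [dQ QN]; exact: (detected_within_complete evalR dQ QN).
have detected_neq1 g (Q : finGroupType) : detected_by Q g -> g <> 1%g.
  move=> [phi [_ phig]] g1; apply: phig; rewrite g1.
  by apply: (mulgI (phi 1%g)); rewrite -gmulfM !mulg1.
(* The detection bound becomes a condition on the finitely many [c] that index the ball. *)
have elt_bound n N : detection_bound X n N <-> forall c, c < size gens ^ n ->
    elt n c <> 1%g -> exists Q : finGroupType, detected_by Q (elt n c) /\ #|Q| <= N.
  split=> [bN c _ c1|bN g g1 /letters_word_length_le[c cn gE]].
    exact/bN/word_length_le_letters.
  by move: g1; rewrite gE -size_gens; apply: bN; rewrite size_gens.
have rfP n := rf_growthP X n hrf.
(* Termination: each product is resolved for all large [L], by completeness of the triviality test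
   if it is 1 and by residual finiteness otherwise; a maximum serves the whole ball. *)
have resolved n : exists L, all_resolved B rels gens n L L.
  suff [L0 L0P] : exists L0, forall c L, c < size gens ^ n -> L0 <= L ->
      trivial_within B rels (product_code B gens n c) L ||
      detected_within B rels (product_code B gens n c) L.
    by exists L0; apply/all_belowP => c cn; apply: L0P.
  elim: (size gens ^ n) => [|j [L0 L0P]]; first by exists 0.
  have [L1 L1P] : exists L1, forall L, L1 <= L ->
      trivial_within B rels (product_code B gens n j) L ||
      detected_within B rels (product_code B gens n j) L.
    have [/trivial_complete[L1 L1P]|/eqP/hrf[Q dQ]] := eqVneq (elt n j) 1%g.
      by exists L1 => L /L1P ->.
    exists #|Q| => L QL; apply/orP; right.
    by apply/detectedP; exists Q.
  exists (maxn L0 L1) => c L; rewrite ltnS leq_eqVlt geq_max.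
  by move=> /orP[/eqP->|cj] /andP[? ?]; [apply: L1P|apply: L0P].
(* At the bound found, a product not proved trivial is detected, hence nontrivial. The triviality
   test is thus exact on the ball, even when [N] is smaller than that bound. *)
have resolvedP n N : all_resolved B rels gens n (ex_minn (resolved n)) N <->
    detection_bound X n N.
  rewrite elt_bound; case: ex_minnP => L /all_belowP resL _; split.
    move=> /all_belowP resN c cn c1; apply/detectedP.
    by have /orP[/trivial_sound|] := resN c cn.
  move=> bN; apply/all_belowP => c cn.
  have /orP[->//|/detectedP[Q [/detected_neq1 c1 _]]] := resL c cn.
  by apply/orP; right; apply/detectedP/bN.
apply: (@computable_least_resolved B rels gens (fun n => ex_minn (resolved n))) => n.
- by case: ex_minnP.
- by move=> L; case: ex_minnP => T _ minT ltLT; apply: contraL ltLT => /minT; rewrite -leqNgt.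
- by have [-> rf_bound _] := rfP n; apply/resolvedP.
- move=> N ltN; apply: contraL ltN => /andP[N0 /resolvedP bN].
  by have [_ _ rf_min] := rfP n; rewrite -leqNgt; apply: rf_min.
Qed.
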